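(* For any integer $n \geq 2$ and any real number $r \geq 0$, \[ \kappa_H(n, r) \leq \frac{2\, B\left( \frac{n-1}{2}, \frac{1}{2} \right)}{B\left( \frac{\operatorname{sech}^2 r}{4}; \frac{n-1}{2}, \frac{1}{2} \right)}. \]
   Context: $\mathbb{H}^n$ denotes $n$-dimensional hyperbolic space. A sphere of radius $r$ in $\mathbb{H}^n$ is the set of points at geodesic distance $r$ from a point (its centre). The kissing number $\kappa_H(n,r)$ is the maximal number of spheres of radius $r$ in $\mathbb{H}^n$, with pairwise disjoint interiors, that simultaneously touch a fixed central sphere of radius $r$ (whose interior is also disjoint from theirs). $B(x; y, z) = \int_0^x t^{y-1}(1-t)^{z-1}\,dt$ is the incomplete beta-function for $x \in [0,1]$, $y,z>0$, and $B(y,z) = B(1;y,z)$. *)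

(* Defs.v *)
From HB Require Import structures.
From mathcomp Require Import all_boot all_order all_algebra.
From mathcomp Require Import all_classical all_reals all_analysis.
Set Implicit Arguments.
Unset Strict Implicit.
Unset Printing Implicit Defensive.
Import Order.TTheory GRing.Theory Num.Theory.
Import numFieldNormedType.Exports.
Local Open Scope classical_set_scope.
Local Open Scope ring_scope.

Definition sech (R : realType) (r : R) : R := 2 / (expR r + expR (- r)).

(* The inverse of cosh : [0, +oo[ -> [1, +oo[. *)
Definition arcosh (R : realType) (x : R) : R := ln (x + Num.sqrt (x ^+ 2 - 1)).

(* Meant for 0 <= x <= 1 and y, z > 0, where the integral is finite. For y < 1
   or z < 1 the integrand is singular at 0 or 1; there powR takes a
   junk value, on a null set. *)
Definition incomplete_beta (R : realType) (x y z : R) : R :=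
  (\int[@lebesgue_measure R]_(t in `[0, x]) (t `^ (y - 1) * (1 - t) `^ (z - 1)))%R.

Definition beta (R : realType) (y z : R) : R := incomplete_beta 1 y z.

(* The Lorentz form, with signature (+, -, ..., -). *)
Definition lorentz (R : realType) (n : nat) (x y : 'rV[R]_n.+1) : R :=
  x 0 0 * y 0 0 - \sum_(i < n) x 0 (lift ord0 i) * y 0 (lift ord0 i).

(* Hyperbolic n-space, as the upper sheet of the hyperboloid in R^(n+1). *)
Definition hyperbolic (R : realType) (n : nat) : Type :=
  {x : 'rV[R]_n.+1 | (lorentz x x == 1) && (0 < x 0 0)}.

(* Geodesic distance for the metric of curvature -1: cosh d(x, y) is the
   Lorentz product of x and y, which is at least 1 on the hyperboloid. *)
Definition hdist (R : realType) (n : nat) (x y : hyperbolic R n) : R :=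
  arcosh (lorentz (val x) (val y)).

Definition hsphere (R : realType) (n : nat) (c : hyperbolic R n) (r : R) :
    set (hyperbolic R n) := [set x | hdist c x = r].

Definition hinterior (R : realType) (n : nat) (c : hyperbolic R n) (r : R) :
    set (hyperbolic R n) := [set x | hdist c x < r].

(* N distinct spheres of radius r, centred at the points c i, all touching the
   sphere of radius r centred at c0. Distinctness of the spheres only matters
   for r = 0, where the interiors are empty. *)
Definition kissing_configuration (R : realType) (n : nat) (r : R) (N : nat)
    (c0 : hyperbolic R n) (c : 'I_N -> hyperbolic R n) : Prop :=
  [/\ injective (fun i => hsphere (c i) r),
      forall i, hsphere (c i) r `&` hsphere c0 r !=set0,
      forall i, hinterior (c i) r `&` hinterior c0 r = set0
    & forall i j, i != j -> hinterior (c i) r `&` hinterior (c j) r = set0].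

(* Taken in the extended reals, so that the value is +oo, not a junk real,
   should the sizes of the configurations be unbounded. *)
Definition kissing_number (R : realType) (n : nat) (r : R) : \bar R :=
  ereal_sup [set (N%:R)%:E | N in
    [set N : nat | exists (c0 : hyperbolic R n) (c : 'I_N -> hyperbolic R n),
       kissing_configuration r c0 c]].

(* Main.v *)
(* By the hyperbolic law of cosines (here: a Gram matrix computation for the
   Lorentz form), the directions in which the centres of the touching spheres
   are seen from the central one are unit vectors of R^n with pairwise inner
   products at most 1 - sech(r)^2 / 2, so the open cones around them of angular
   radius a, sin(a)^2 = sech(r)^2 / 4, are disjoint. To compare the measure of
   such a cone with that of R^n, both intersected with the unit ball, write
   R^n = R * R^(n-1): the measure is invariant under rotations, because plane
   rotations are products of shears, so the axis of the cone can be taken to be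
   the first factor. On R^(n-1) the law of |x|^2 has density proportional to
   s^((n-1)/2-1), on R the law of y^2 has density proportional to w^(-1/2), and
   for these s / (w + s) has a beta law, independent of w + s. *)
From HB Require Import structures.
Require Import Defs.
From mathcomp Require Import all_boot all_order all_algebra.
From mathcomp Require Import all_classical all_reals all_analysis.
From mathcomp Require Import measurable_realfun ring lra.
Set Implicit Arguments.
Unset Strict Implicit.
Unset Printing Implicit Defensive.
Import Order.TTheory GRing.Theory Num.Theory.
Import numFieldNormedType.Exports.
Local Open Scope classical_set_scope.
Local Open Scope ring_scope.

(** * Hyperbolic geometry *)

(** Lagrange's argument: [A * (A * B - C ^+ 2)] is the sum of the squares of [C * a i - A * b i].
    Dividing by [A] requires [A > 0]; if [A = 0], all the [a i] vanish. *)
Lemma sum_CauchySchwarz (R : realFieldType) (I : finType) (a b : I -> R) :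
  (\sum_i a i * b i) ^+ 2 <= (\sum_i a i ^+ 2) * (\sum_i b i ^+ 2).
Proof.
set A := \sum_i a i ^+ 2; set B := \sum_i b i ^+ 2; set C := \sum_i a i * b i.
have A0 : 0 <= A by apply: sumr_ge0 => i _; exact: sqr_ge0.
have key : 0 <= A * (A * B - C ^+ 2).
  have -> : A * (A * B - C ^+ 2) = \sum_i (C * a i - A * b i) ^+ 2.
    transitivity (C ^+ 2 * A - 2 * A * C * C + A ^+ 2 * B); first by ring.
    rewrite [X in X - _]mulr_sumr [X in _ - X + _]mulr_sumr -sumrB.
    rewrite [X in _ + X]mulr_sumr -big_split /=.
    by apply: eq_bigr => i _; ring.
  by apply: sumr_ge0 => i _; exact: sqr_ge0.
move: A0; rewrite le_eqVlt => /predU1P[A0|A0]; last first.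
  by move: key; rewrite pmulr_rge0// subr_ge0.
have a0 i : a i = 0.
  apply/eqP; rewrite -sqrf_eq0; apply/eqP; move: i isT; apply/psumr_eq0P => //.
  by move=> i _; exact: sqr_ge0.
by rewrite -A0 mul0r /C big1 ?expr0n// => i _; rewrite a0 mul0r.
Qed.

Definition cosh (R : realType) (r : R) : R := (expR r + expR (- r)) / 2.

Section hyperbolic_cosine.
Variable R : realType.
Implicit Types a b r : R.

Lemma arcosh_cosh r : 0 <= r -> arcosh (cosh r) = r.
Proof.
move=> r0; rewrite /arcosh.
have e1 : expR (- r) <= expR r by rewrite ler_expR; lra.
have ee : expR r * expR (- r) = 1 by rewrite -expRD subrr expR0.
have -> : cosh r ^+ 2 - 1 = ((expR r - expR (- r)) / 2) ^+ 2.
  by rewrite -[X in _ - X]ee /cosh; field.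
rewrite sqrtr_sqr ger0_norm; last by rewrite divr_ge0// subr_ge0.
by rewrite (_ : _ + _ = expR r) ?expRK// /cosh; field.
Qed.

Lemma cosh_arcosh a : 1 <= a -> cosh (arcosh a) = a.
Proof.
move=> a1; have a2 : 0 <= a ^+ 2 - 1 by nra.
have s0 := sqrtr_ge0 (a ^+ 2 - 1); have ss := sqr_sqrtr a2.
rewrite /cosh /arcosh expRN lnK ?posrE; last lra.
have y0 : a + Num.sqrt (a ^+ 2 - 1) != 0 by apply: lt0r_neq0; lra.
have -> : (a + Num.sqrt (a ^+ 2 - 1))^-1 = a - Num.sqrt (a ^+ 2 - 1).
  by apply: (mulfI y0); rewrite mulfV// mulrC -subr_sqr ss; ring.
by field.
Qed.

Lemma arcosh_lt a b : 1 <= a -> a < b -> arcosh a < arcosh b.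
Proof.
move=> a1 ab; rewrite /arcosh.
have sa := sqrtr_ge0 (a ^+ 2 - 1); have sb := sqrtr_ge0 (b ^+ 2 - 1).
have : Num.sqrt (a ^+ 2 - 1) <= Num.sqrt (b ^+ 2 - 1) by apply: ler_wsqrtr; nra.
by move=> sab; rewrite ltr_ln ?posrE; lra.
Qed.

Lemma cosh_gt1 r : 0 < r -> 1 < cosh r.
Proof.
move=> r0; have e1 : 1 < expR r by rewrite expR_gt1.
have ee : expR r * expR (- r) = 1 by rewrite -expRD subrr expR0.
have e0 := expR_gt0 (- r).
rewrite /cosh; nra.
Qed.

End hyperbolic_cosine.

(** * The Lorentz form and the mutual position of balls *)

Section lorentz_form.
Variables (R : realType) (n : nat).
Implicit Types (x y z : 'rV[R]_n.+1) (a b c : hyperbolic R n).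

Lemma lorentz_def x y : lorentz x y =
  x 0 0 * y 0 0 - \sum_(i < n) x 0 (lift ord0 i) * y 0 (lift ord0 i).
Proof. by []. Qed.

Lemma lorentzC x y : lorentz x y = lorentz y x.
Proof.
by rewrite /lorentz mulrC; congr (_ - _); apply: eq_bigr => i _; rewrite mulrC.
Qed.

Lemma lorentzDl x y z : lorentz (x + y) z = lorentz x z + lorentz y z.
Proof.
rewrite /lorentz !mxE [X in _ - X](_ : _ = \sum_(i < n) x 0 (lift ord0 i) * z 0 (lift ord0 i) +
  \sum_(i < n) y 0 (lift ord0 i) * z 0 (lift ord0 i)); first by ring.
by rewrite -big_split; apply: eq_bigr => i _; rewrite !mxE mulrDl.
Qed.

Lemma lorentzZl (k : R) x y : lorentz (k *: x) y = k * lorentz x y.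
Proof.
rewrite /lorentz !mxE mulrBr mulr_sumr mulrA; congr (_ - _).
by apply: eq_bigr => i _; rewrite !mxE mulrA.
Qed.

Lemma lorentzDr x y z : lorentz x (y + z) = lorentz x y + lorentz x z.
Proof. by rewrite lorentzC lorentzDl !(lorentzC x). Qed.

Lemma lorentzZr (k : R) x y : lorentz x (k *: y) = k * lorentz x y.
Proof. by rewrite lorentzC lorentzZl lorentzC. Qed.

Definition lorentzE := (lorentzDl, lorentzDr, lorentzZl, lorentzZr).

Lemma lorentz_hyperbolic a : lorentz (val a) (val a) = 1.
Proof. by have /andP[/eqP] := valP a. Qed.

Lemma hyperbolic_gt0 a : 0 < val a 0 0.
Proof. by have /andP[] := valP a. Qed.

Lemma hyperbolic_spatial a :
  \sum_(i < n) val a 0 (lift ord0 i) ^+ 2 = val a 0 0 ^+ 2 - 1.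
Proof.
have /eqP := lorentz_hyperbolic a; rewrite lorentz_def -expr2 subr_eq.
by under eq_bigr do rewrite -expr2; move=> /eqP ->; ring.
Qed.

(** The orthogonal of a timelike vector is spacelike: orthogonality gives [p * y] as the Euclidean
    product of the spatial parts, so Cauchy-Schwarz yields [(p * y) ^+ 2 <= (p ^+ 2 - 1) * B]. *)
Lemma lorentz_orthogonal_le0 a x : lorentz (val a) x = 0 -> lorentz x x <= 0.
Proof.
move=> /eqP; rewrite subr_eq0 => /eqP ax.
have := sum_CauchySchwarz (fun i => val a 0 (lift ord0 i)) (fun i => x 0 (lift ord0 i)).
rewrite -ax hyperbolic_spatial lorentz_def.
under [X in _ -> _ - X <= _]eq_bigr do rewrite -expr2.
have := hyperbolic_gt0 a.
set p := val a 0 0; set y := x 0 0; set B := \sum_i _ => p0.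
have B0 : 0 <= B by apply: sumr_ge0 => i _; exact: sqr_ge0.
move=> h; rewrite subr_le0 -expr2 -(ler_pM2l (exprn_gt0 2 p0)).
by nra.
Qed.

(** Reversed Cauchy-Schwarz inequality. The product [L] is positive by Cauchy-Schwarz on the spatial
    parts; then [b - L a] is orthogonal to [a] and its Lorentz square [1 - L ^+ 2] cannot be
    positive. *)
Lemma lorentz_ge1 a b : 1 <= lorentz (val a) (val b).
Proof.
have L0 : 0 < lorentz (val a) (val b).
  have := sum_CauchySchwarz (fun i => val a 0 (lift ord0 i)) (fun i => val b 0 (lift ord0 i)).
  rewrite !hyperbolic_spatial lorentz_def.
  have a0 := hyperbolic_gt0 a; have b0 := hyperbolic_gt0 b.
  have sa : 0 <= val a 0 0 ^+ 2 - 1.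
    by rewrite -hyperbolic_spatial; apply: sumr_ge0 => i _; exact: sqr_ge0.
  have ab0 := mulr_gt0 a0 b0.
  move: sa a0 b0 ab0; set p := val a 0 0; set q := val b 0 0; set S := \sum_i _.
  move=> sa a0 b0 ab0 h; rewrite subr_gt0 ltNge; apply/negP => pqS.
  have : (p * q) ^+ 2 <= S ^+ 2.
    by rewrite ler_sqr ?nnegrE ?(ltW ab0)// (le_trans (ltW ab0)).
  have q2 : 0 < q ^+ 2 by rewrite exprn_gt0.
  nra.
set L := lorentz (val a) (val b) in L0 *.
have : lorentz (val a) (val b + (- L) *: val a) = 0.
  by rewrite !lorentzE lorentz_hyperbolic -/L; ring.
move=> /lorentz_orthogonal_le0; rewrite !lorentzE !lorentz_hyperbolic.
rewrite (lorentzC (val b)) -/L; nra.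
Qed.

(** The difference [v] of the two points is orthogonal to [a] and null. Cauchy-Schwarz then forces
    its time coordinate to vanish, and nullity does the same to the spatial ones. *)
Lemma lorentz_eq1 a b : lorentz (val a) (val b) = 1 -> a = b.
Proof.
move=> ab1; pose v := val b + (-1) *: val a.
have av : lorentz (val a) v = 0.
  by rewrite /v !lorentzE ab1 lorentz_hyperbolic; ring.
have vv : lorentz v v = 0.
  by rewrite /v !lorentzE !lorentz_hyperbolic (lorentzC (val b)) ab1; ring.
have := sum_CauchySchwarz (fun i => val a 0 (lift ord0 i)) (fun i => v 0 (lift ord0 i)).
move/eqP : av; rewrite lorentz_def subr_eq0 => /eqP <-.
move/eqP : vv; rewrite lorentz_def -expr2 subr_eq0; under eq_bigr do rewrite -expr2.
move=> /eqP vv; rewrite hyperbolic_spatial -vv exprMn mulrBl mul1r.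
rewrite -subr_ge0 addrAC subrr add0r oppr_ge0 => v0.
have {}v0 : v 0 0 = 0 by apply/eqP; rewrite -sqrf_eq0 eq_le v0 sqr_ge0.
have {}vv : v = 0.
  apply/rowP => k; rewrite [RHS]mxE; case: (unliftP ord0 k) => [j|] ->//.
  apply/eqP; rewrite -sqrf_eq0; apply/eqP; move: j isT.
  apply/psumr_eq0P; first by move=> i _; exact: sqr_ge0.
  by rewrite -vv v0 expr0n.
apply: val_inj; apply/eqP; rewrite eq_sym -subr_eq0; apply/eqP.
by rewrite -vv /v scaleN1r.
Qed.

(** The triangle inequality through a common point [c], with cosh(2r) written as
    [2 * cosh r ^+ 2 - 1]: the vector [a + b - 2 (cosh r) c] is orthogonal to [c], so its Lorentz
    square is at most 0. *)
Lemma lorentz_touching a b (r : R) :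
  hsphere a r `&` hsphere b r !=set0 ->
  lorentz (val a) (val b) <= 2 * cosh r ^+ 2 - 1.
Proof.
move=> [c [/= ac bc]].
have {}ac : lorentz (val a) (val c) = cosh r by rewrite -ac cosh_arcosh// lorentz_ge1.
have {}bc : lorentz (val b) (val c) = cosh r by rewrite -bc cosh_arcosh// lorentz_ge1.
have : lorentz (val c) (val a + val b + (- (2 * cosh r)) *: val c) = 0.
  by rewrite !lorentzE lorentz_hyperbolic !(lorentzC (val c)) ac bc; ring.
move=> /lorentz_orthogonal_le0; rewrite !lorentzE !lorentz_hyperbolic.
rewrite !(lorentzC (val c)) ac bc (lorentzC (val b)); nra.
Qed.

(* Otherwise the midpoint of a and b lies in both interiors. *)
Lemma lorentz_disjoint a b (r : R) : 0 < r ->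
  hinterior a r `&` hinterior b r = set0 ->
  2 * cosh r ^+ 2 - 1 <= lorentz (val a) (val b).
Proof.
move=> r0 ab0; rewrite leNgt; apply/negP => Llt.
have L1 := lorentz_ge1 a b; have C1 := cosh_gt1 r0.
set L := lorentz (val a) (val b) in Llt L1.
have L2 : 0 < 2 + 2 * L by lra.
set w := Num.sqrt (2 + 2 * L).
have w0 : 0 < w by rewrite sqrtr_gt0.
have ww : w ^+ 2 = 2 + 2 * L by rewrite sqr_sqrtr// ltW.
have wn0 : w != 0 by rewrite gt_eqF.
(* The Lorentz square of [a + b] is [2 + 2 * L = w ^+ 2], so [m] is the midpoint, normalised to lie
   on the hyperboloid. *)
pose m := w^-1 *: (val a + val b).
have mm : lorentz m m = 1.
  rewrite /m !lorentzE !lorentz_hyperbolic (lorentzC (val b)) -/L.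
  have -> : w^-1 * (w^-1 * (1 + L) + w^-1 * (L + 1)) = (2 + 2 * L) / w ^+ 2 by field.
  by rewrite -ww divff// sqrf_eq0.
have m0 : 0 < m 0 0.
  by rewrite !mxE mulr_gt0 ?invr_gt0// addr_gt0// hyperbolic_gt0.
have mH : (lorentz m m == 1) && (0 < m 0 0) by rewrite mm eqxx.
pose M : hyperbolic R n := exist _ m mH.
(* The left side, the cosh of the distance from [m] to either centre, equals [w / 2], and
   [w ^+ 2 < 4 * cosh r ^+ 2] by [Llt]. *)
have half : (1 + L) / w < cosh r.
  rewrite ltr_pdivrMr//; have -> : 1 + L = w ^+ 2 / 2 by rewrite ww; field.
  nra.
have am : lorentz (val a) m = (1 + L) / w.
  by rewrite /m !lorentzE lorentz_hyperbolic -/L; field.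
have bm : lorentz (val b) m = (1 + L) / w.
  by rewrite /m !lorentzE lorentz_hyperbolic (lorentzC (val b)) -/L; field.
suff : (hinterior a r `&` hinterior b r) M by rewrite ab0.
split; rewrite /hinterior/= /hdist/=.
- rewrite -[ltRHS](arcosh_cosh (ltW r0)) arcosh_lt// ?am//.
  by rewrite -am (lorentz_ge1 a M).
- rewrite -[ltRHS](arcosh_cosh (ltW r0)) arcosh_lt// ?bm//.
  by rewrite -bm (lorentz_ge1 b M).
Qed.

(* The boost taking a to the apex of the hyperboloid, restricted to the
   orthogonal of a; it is an isometry onto the Euclidean space. *)
Definition boost a x (i : 'I_n) : R :=
  x 0 (lift ord0 i) - val a 0 (lift ord0 i) * (x 0 0 / (1 + val a 0 0)).

(** Expanding the product leaves the spatial products of [a] with [x] and [y], which orthogonality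
    expresses by time coordinates, and the spatial square of [a], which is [p ^+ 2 - 1]. *)
Lemma boost_isometry a x y :
  lorentz (val a) x = 0 -> lorentz (val a) y = 0 ->
  \sum_(i < n) boost a x i * boost a y i = - lorentz x y.
Proof.
move=> /eqP; rewrite subr_eq0 => /eqP ax /eqP; rewrite subr_eq0 => /eqP ay.
have := hyperbolic_gt0 a; have := hyperbolic_spatial a.
set p := val a 0 0 in ax ay * => pp p0.
have p1 : 1 + p != 0 by rewrite gt_eqF// addr_gt0.
pose s := x 0 0 / (1 + p); pose t := y 0 0 / (1 + p).
transitivity (\sum_(i < n) x 0 (lift ord0 i) * y 0 (lift ord0 i)
   - t * (\sum_(i < n) val a 0 (lift ord0 i) * x 0 (lift ord0 i))
   - s * (\sum_(i < n) val a 0 (lift ord0 i) * y 0 (lift ord0 i))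
   + s * t * (\sum_(i < n) val a 0 (lift ord0 i) ^+ 2)).
  rewrite !mulr_sumr -!sumrB -big_split; apply: eq_bigr => i _.
  by rewrite /boost -/p -/s -/t /=; ring.
by rewrite -ax -ay pp lorentz_def /s /t; field.
Qed.

(** Touching and disjointness together put every centre at Lorentz product exactly [K] = cosh(2r)
    from [c0]. The vectors [v i] are the projections of the centres to the orthogonal of [c0], which
    are boosted to Euclidean space and divided by their common length [S]. *)
Lemma kissing_unit_vectors (r : R) (N : nat) (c0 : hyperbolic R n)
    (c : 'I_N -> hyperbolic R n) :
  0 < r -> kissing_configuration r c0 c ->
  exists u : 'I_N -> 'I_n -> R,
    (forall i, \sum_k u i k ^+ 2 = 1) /\
    (forall i j, i != j -> \sum_k u i k * u j k <= 1 - sech r ^+ 2 / 2).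
Proof.
move=> r0 [_ touch int0 int].
have C1 := cosh_gt1 r0.
have CE : sech r = (cosh r)^-1 by rewrite /sech /cosh invf_div.
set C := cosh r in CE C1; pose K := 2 * C ^+ 2 - 1.
have K1 : 1 < K by rewrite /K; nra.
have cK i : lorentz (val (c i)) (val c0) = K.
  by apply/eqP; rewrite eq_le lorentz_touching//= lorentz_disjoint.
pose v i : 'rV_n.+1 := val (c i) + (- K) *: val c0.
have v0 i : lorentz (val c0) (v i) = 0.
  by rewrite /v !lorentzE lorentz_hyperbolic lorentzC cK; ring.
have vv i j : - lorentz (v i) (v j) = K ^+ 2 - lorentz (val (c i)) (val (c j)).
  by rewrite /v !lorentzE lorentz_hyperbolic (lorentzC (val c0)) !cK; ring.
have K20 : 0 < K ^+ 2 - 1 by nra.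
pose S := Num.sqrt (K ^+ 2 - 1).
have S0 : 0 < S by rewrite sqrtr_gt0.
have SS : S ^+ 2 = K ^+ 2 - 1 by rewrite sqr_sqrtr// ltW.
have uu i j : \sum_k (boost c0 (v i) k / S) * (boost c0 (v j) k / S) =
    (K ^+ 2 - lorentz (val (c i)) (val (c j))) / (K ^+ 2 - 1).
  rewrite -vv -SS -(boost_isometry (v0 i) (v0 j)) mulr_suml; apply: eq_bigr => k _.
  by field; rewrite gt_eqF.
exists (fun i k => boost c0 (v i) k / S); split=> [i|i j ij].
  under eq_bigr do rewrite expr2.
  by rewrite uu lorentz_hyperbolic divff// gt_eqF.
(* Two centres have Lorentz product at least [K], so the inner product is at most [(K ^+ 2 - K) / (K
   ^+ 2 - 1) = K / (K + 1)], where [K + 1 = 2 * C ^+ 2]. *)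
rewrite uu CE ler_pdivrMr//.
have := lorentz_disjoint r0 (int i j ij); rewrite -/K.
have -> : (1 - C^-1 ^+ 2 / 2) * (K ^+ 2 - 1) = K ^+ 2 - K.
  by rewrite /K; field; rewrite gt_eqF// (lt_trans _ C1).
lra.
Qed.

(** Touching at radius 0 makes each centre equal to [c0], and distinctness of the spheres then
    leaves room for one only. *)
Lemma kissing_radius0 (N : nat) (c0 : hyperbolic R n)
    (c : 'I_N -> hyperbolic R n) :
  kissing_configuration 0 c0 c -> (N <= 1)%N.
Proof.
move=> [inj touch _ _].
have cE i : c i = c0.
  apply/lorentz_eq1/eqP; rewrite eq_le lorentz_ge1 andbT.
  apply: (le_trans (lorentz_touching (touch i))).
  by rewrite /cosh oppr0 expR0; lra.
case: N c inj touch cE => [//|[//|N]] c inj _ cE.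
have /inj : hsphere (c ord0) 0 = hsphere (c ord_max) 0 by rewrite !cE.
by move/(congr1 val).
Qed.

End lorentz_form.

(** * Lebesgue integrals on the line *)

Section change_of_variables.
Local Open Scope ereal_scope.
Variable R : realType.
Local Notation leb := (@lebesgue_measure R).
Implicit Types f : R -> \bar R.

Lemma eq_integral_lebesgue (mu : {measure set (measurableTypeR R) -> \bar R}) f :
  (forall a b : R, (a <= b)%R -> mu `]a, b]%classic = (b - a)%:E) ->
  \int[leb]_x f x = \int[mu]_x f x.
Proof.
move=> H; apply: eq_measure_integral => A mA _.
apply: lebesgue_measure_unique => // X [[a b] _ <-]/=.
rewrite lebesgue_measure_itv/= lte_fin; case: ltP => ab.
  by rewrite H ?ltW// EFinB.
by rewrite set_itv_ge ?measure0// -leNgt bnd_simp.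
Qed.

(** The image of Lebesgue measure under [phi], scaled by [k], gives half-open intervals their
    length, hence is Lebesgue measure. Translations, the reflection and scalings are the
    instances. *)
Lemma ge0_integral_dilation (phi : R -> R) (k : {nonneg R}) f :
  measurable_fun [set: R] phi ->
  (forall a b : R, (a <= b)%R -> k%:num%:E * leb (phi @^-1` `]a, b]) = (b - a)%:E) ->
  measurable_fun [set: R] f -> (forall x, 0 <= f x) ->
  \int[leb]_x f x = k%:num%:E * \int[leb]_x f (phi x).
Proof.
move=> mphi H mf f0.
have mphi' : measurable_fun [set: R] (phi : R -> measurableTypeR R) by [].
pose nu : {measure set (measurableTypeR R) -> \bar R} :=
  measure_function_pushforward__canonical__measure_function_Measure leb mphi'.
rewrite [LHS](eq_integral_lebesgue (mu := mscale k nu))//.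
by rewrite ge0_integral_mscale//= ge0_integral_pushforward.
Qed.

Lemma ge0_integral_translate f (c : R) :
  measurable_fun [set: R] f -> (forall x, 0 <= f x) ->
  \int[leb]_x f (x + c)%R = \int[leb]_x f x.
Proof.
move=> mf f0.
rewrite [RHS](@ge0_integral_dilation (fun x => x + c)%R 1%:nng%R) ?mul1e//.
  exact: measurable_funD.
move=> a b ab; rewrite mul1e.
rewrite (_ : _ @^-1` _ = `](a - c)%R, (b - c)%R]%classic); last first.
  by apply/seteqP; split=> x/=; rewrite !in_itv/= ltrBlDr lerBrDr.
rewrite lebesgue_measure_itv/= lte_fin; case: ltP => ab'.
  by rewrite -EFinB; congr EFin; ring.
by congr EFin; lra.
Qed.

Lemma ge0_integral_opp f :
  measurable_fun [set: R] f -> (forall x, 0 <= f x) ->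
  \int[leb]_x f (- x)%R = \int[leb]_x f x.
Proof.
move=> mf f0.
rewrite [RHS](@ge0_integral_dilation (fun x => - x)%R 1%:nng%R) ?mul1e//.
  exact: measurable_funN.
move=> a b ab; rewrite mul1e.
rewrite (_ : _ @^-1` _ = `[(- b)%R, (- a)%R[%classic); last first.
  by apply/seteqP; split=> x/=; rewrite !in_itv/= andbC lerNl ltrNr.
rewrite lebesgue_measure_itv/= lte_fin; case: ltP => ab'.
  by rewrite -EFinB; congr EFin; ring.
by congr EFin; lra.
Qed.

Lemma ge0_integral_scale f (c : R) : (0 < c)%R ->
  measurable_fun [set: R] f -> (forall x, 0 <= f x) ->
  \int[leb]_x f x = c%:E * \int[leb]_x f (c * x)%R.
Proof.
move=> c0 mf f0.
rewrite [LHS](@ge0_integral_dilation (fun x => c * x)%R (NngNum (ltW c0)))//.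
  exact: measurable_funM.
move=> a b ab.
rewrite (_ : _ @^-1` _ = `](a / c)%R, (b / c)%R]%classic); last first.
  by apply/seteqP; split=> x/=; rewrite !in_itv/= ltr_pdivrMr// ler_pdivlMr// mulrC.
rewrite lebesgue_measure_itv/= lte_fin ltr_pM2r ?invr_gt0//; case: ltP => ab'.
  by rewrite -EFinB -EFinM; congr EFin; field; rewrite gt_eqF.
by rewrite mule0; congr EFin; lra.
Qed.

End change_of_variables.

Section measurability.
Local Open Scope ereal_scope.
Context {R : realType}.

Section one_variable.
Context d (T : measurableType d).
Implicit Types f g : T -> R.

(** This lemma and the next ones state closure properties for functions written pointwise, the shape
    in which the tactic [measurability] meets them. *)
Lemma measurable_addf f g : measurable_fun [set: T] f -> measurable_fun [set: T] g ->
  measurable_fun [set: T] (fun x => f x + g x)%R.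
Proof. exact: measurable_funD. Qed.

Lemma measurable_subf f g : measurable_fun [set: T] f -> measurable_fun [set: T] g ->
  measurable_fun [set: T] (fun x => f x - g x)%R.
Proof. exact: measurable_funB. Qed.

Lemma measurable_oppf f : measurable_fun [set: T] f ->
  measurable_fun [set: T] (fun x => - f x)%R.
Proof. exact: measurable_funN. Qed.

Lemma measurable_mulf f g : measurable_fun [set: T] f -> measurable_fun [set: T] g ->
  measurable_fun [set: T] (fun x => f x * g x)%R.
Proof. exact: measurable_funM. Qed.

Lemma measurable_expf f n : measurable_fun [set: T] f ->
  measurable_fun [set: T] (fun x => f x ^+ n)%R.
Proof. exact: measurable_funX. Qed.

Lemma measurable_powf f (a : R) : measurable_fun [set: T] f ->
  measurable_fun [set: T] (fun x => f x `^ a)%R.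
Proof. by move=> mf; apply: (measurableT_comp (measurable_powR a)). Qed.

Lemma measurable_ltf f g : measurable_fun [set: T] f -> measurable_fun [set: T] g ->
  measurable_fun [set: T] (fun x => (f x < g x)%R%:R : R).
Proof.
move=> mf mg.
rewrite (_ : (fun x => _) = (fun x => if (f x < g x)%R then 1%R else 0%R : R)).
  by apply: measurable_fun_ifT => //; exact: measurable_fun_ltr.
by apply/funext => x; case: ifP.
Qed.

Lemma measurable_lef f g : measurable_fun [set: T] f -> measurable_fun [set: T] g ->
  measurable_fun [set: T] (fun x => (f x <= g x)%R%:R : R).
Proof.
move=> mf mg.
rewrite (_ : (fun x => _) = (fun x => if (f x <= g x)%R then 1%R else 0%R : R)).
  by apply: measurable_fun_ifT => //; exact: measurable_fun_ler.
by apply/funext => x; case: ifP.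
Qed.

Lemma measurable_sumf (I : finType) (F : I -> T -> R) :
  (forall i, measurable_fun [set: T] (F i)) ->
  measurable_fun [set: T] (fun x => \sum_i F i x)%R.
Proof. by move=> mF; exact: measurable_sum. Qed.

Lemma measurable_EFinf f : measurable_fun [set: T] f ->
  measurable_fun [set: T] (fun x => (f x)%:E).
Proof. by move=> mf; exact/measurable_EFinP. Qed.

Lemma measurable_mulef (f g : T -> \bar R) :
  measurable_fun [set: T] f -> measurable_fun [set: T] g ->
  measurable_fun [set: T] (fun x => f x * g x).
Proof. exact: emeasurable_funM. Qed.

Lemma measurable_compf (h : R -> \bar R) f :
  measurable_fun [set: R] h -> measurable_fun [set: T] f ->
  measurable_fun [set: T] (fun x => h (f x)).
Proof. by move=> mh mf; exact: (measurableT_comp mh). Qed.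

Lemma measurable_comp2f (h : R * R -> \bar R) f g :
  measurable_fun [set: R * R] h ->
  measurable_fun [set: T] f -> measurable_fun [set: T] g ->
  measurable_fun [set: T] (fun x => h (f x, g x)).
Proof.
by move=> mh mf mg; apply: (measurableT_comp mh); exact: measurable_fun_pair.
Qed.

Lemma measurable_fstf d1 d2 (T1 : measurableType d1) (T2 : measurableType d2)
    (h : T -> T1 * T2) :
  measurable_fun [set: T] h -> measurable_fun [set: T] (fun x => (h x).1).
Proof. by move=> mh; exact: (measurableT_comp measurable_fst). Qed.

Lemma measurable_sndf d1 d2 (T1 : measurableType d1) (T2 : measurableType d2)
    (h : T -> T1 * T2) :
  measurable_fun [set: T] h -> measurable_fun [set: T] (fun x => (h x).2).
Proof. by move=> mh; exact: (measurableT_comp measurable_snd). Qed.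

End one_variable.

Section two_variables.
Context d1 d2 (T1 : measurableType d1) (T2 : measurableType d2).
Variables (m1 : {sigma_finite_measure set T1 -> \bar R}).
Variables (m2 : {sigma_finite_measure set T2 -> \bar R}).
Variable f : T1 -> T2 -> \bar R.
Hypothesis mf : measurable_fun [set: T1 * T2] (fun z => f z.1 z.2).
Hypothesis f0 : forall x y, 0 <= f x y.

Lemma ge0_integral_swap :
  \int[m1]_x \int[m2]_y f x y = \int[m2]_y \int[m1]_x f x y.
Proof. by rewrite (fubini_tonelli (fun z => f z.1 z.2))// => -[x y]/=. Qed.

Lemma measurable_integralf : measurable_fun [set: T1] (fun x => \int[m2]_y f x y).
Proof. by apply: (measurable_fun_fubini_tonelli_F (fun z => f z.1 z.2)). Qed.

End two_variables.
End measurability.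
Arguments ge0_integral_swap {R d1 d2 T1 T2 m1 m2} f.
Arguments measurable_integralf {R d1 d2 T1 T2} m2 {f}.

Section power_density.
Local Open Scope ereal_scope.
Variable R : realType.
Local Notation leb := (@lebesgue_measure R).

(** The indicator of the half-line is a real factor, so that all integrals run over the whole line
    and a substitution only changes the integrand. *)
Definition power_density (a s : R) : R := ((0 < s)%R%:R * s `^ (a - 1))%R.

Lemma power_density_ge0 a s : (0 <= power_density a s)%R.
Proof. by rewrite mulr_ge0 ?powR_ge0. Qed.

Lemma power_density_le0 a s : (s <= 0)%R -> power_density a s = 0%R.
Proof. by move=> s0; rewrite /power_density ltNge s0 mul0r. Qed.

Lemma power_densityM a s t : (0 < s)%R ->
  power_density a (s * t) = (s `^ (a - 1) * power_density a t)%R.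
Proof.
move=> s0; rewrite /power_density pmulr_rgt0//.
have [t0|t0] := ltP 0%R t; last by rewrite !mul0r mulr0.
by rewrite !mul1r powRM// ltW.
Qed.

Lemma measurable_power_density d (T : measurableType d) (f : T -> R) a :
  measurable_fun [set: T] f ->
  measurable_fun [set: T] (fun x => power_density a (f x)).
Proof.
by move=> mf; apply: measurable_mulf; [exact: measurable_ltf|exact: measurable_powf].
Qed.

End power_density.

Ltac measurability := repeat first
  [ assumption
  | exact: measurable_cst
  | exact: measurable_id
  | exact: measurable_fst
  | exact: measurable_snd
  | apply: measurable_EFinf
  | apply: measurable_mulef
  | match goal with |- measurable_fun _ (fun _ => power_density _ _) =>
      apply: measurable_power_density end
  | apply: measurable_mulf
  | apply: measurable_subf
  | apply: measurable_addf
  | apply: measurable_oppf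
  | apply: measurable_expf
  | apply: measurable_powf
  | apply: measurable_ltf
  | apply: measurable_lef
  | apply: measurable_comp2f
  | apply: measurable_compf
  | apply: measurable_fstf
  | apply: measurable_sndf
  | match goal with mf : measurable_fun _ _ |- _ => apply: (measurableT_comp mf) end ].

(** * Rotation invariance in the plane, by shears *)

Section plane_rotation.
Local Open Scope ereal_scope.
Variable R : realType.
Local Notation leb := (@lebesgue_measure R).

Lemma ge0_lebesgue_swap (f : R -> R -> \bar R) :
  measurable_fun [set: R * R] (fun z => f z.1 z.2) -> (forall x y, 0 <= f x y) ->
  \int[leb]_x \int[leb]_y f x y = \int[leb]_y \int[leb]_x f x y.
Proof. by move=> mf f0; exact: (@ge0_integral_swap R _ _ _ _ leb leb f). Qed.

Section shear.
Variable G : R * R -> \bar R.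
Hypothesis mG : measurable_fun [set: R * R] G.
Hypothesis G0 : forall z, 0 <= G z.

Lemma ge0_integral_shear2 (b : R) :
  \int[leb]_y \int[leb]_t G (y, t + b * y)%R = \int[leb]_y \int[leb]_t G (y, t).
Proof.
apply: eq_integral => y _; apply: (ge0_integral_translate (f := fun t => G (y, t))) => //.
by measurability.
Qed.

Lemma ge0_integral_shear1 (a : R) :
  \int[leb]_y \int[leb]_t G (y + a * t, t)%R = \int[leb]_y \int[leb]_t G (y, t).
Proof.
transitivity (\int[leb]_t \int[leb]_y G (y + a * t, t)%R).
  refine (ge0_lebesgue_swap (f := fun y t : R => G (y + a * t, t)%R) _ _) => //.
  by measurability.
transitivity (\int[leb]_t \int[leb]_y G (y, t)); last first.
  symmetry; refine (ge0_lebesgue_swap (f := fun y t : R => G (y, t)) _ _) => //.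
  by measurability.
apply: eq_integral => t _; apply: (ge0_integral_translate (f := fun y => G (y, t))) => //.
by measurability.
Qed.

End shear.

Variable k : R * R -> \bar R.
Hypothesis mk : measurable_fun [set: R * R] k.
Hypothesis k0 : forall z, 0 <= k z.

(* A rotation by an angle other than pi is a product of three shears. *)
Let ge0_integral_rotation_nonneg (p q : R) : (0 <= p)%R -> (p ^+ 2 + q ^+ 2 = 1)%R ->
  \int[leb]_y \int[leb]_t k (y ^+ 2 + t ^+ 2, p * y + q * t)%R =
  \int[leb]_y \int[leb]_t k (y ^+ 2 + t ^+ 2, y)%R.
Proof.
move=> p0 pq.
have p1 : (1 + p != 0)%R by apply: lt0r_neq0; lra.
(* With [p] and [q] the cosine and sine of an angle, [a] is the tangent of half the angle; the
   shears by [a], [b] and [a] compose to the rotation. *)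
pose a := (q / (1 + p))%R; pose b := (- q)%R.
have ab : (1 + a * b = p)%R.
  have -> : (1 + a * b = (1 + p - q ^+ 2) / (1 + p))%R by rewrite /a /b; field.
  by rewrite (_ : q ^+ 2 = 1 - p ^+ 2)%R; [field|lra].
have aq : (a * (1 + p) = q)%R by rewrite /a mulfVK.
pose G0 (z : R * R) := k (z.1 ^+ 2 + z.2 ^+ 2, z.1)%R.
pose G1 (z : R * R) := G0 (z.1 + a * z.2, z.2)%R.
pose G2 (z : R * R) := G1 (z.1, z.2 + b * z.1)%R.
have mG0 : measurable_fun [set: R * R] G0 by rewrite /G0; measurability.
have mG1 : measurable_fun [set: R * R] G1 by rewrite /G1; measurability.
have mG2 : measurable_fun [set: R * R] G2 by rewrite /G2; measurability.
have G00 z : 0 <= G0 z by exact: k0.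
have G10 z : 0 <= G1 z by exact: k0.
have G20 z : 0 <= G2 z by exact: k0.
rewrite -[RHS](ge0_integral_shear1 mG0 G00 a) -[RHS](ge0_integral_shear2 mG1 G10 b).
rewrite -[RHS](ge0_integral_shear1 mG2 G20 a).
apply: eq_integral => y _; apply: eq_integral => t _.
rewrite /G2 /G1 /G0/=; set s := (t + b * (y + a * t))%R.
have sE : (s = p * t - q * y)%R by rewrite -ab /s /b; ring.
have -> : (y + a * t + a * s = p * y + q * t)%R.
  rewrite sE -aq -[X in (X * y + _)%R]ab -/b.
  by rewrite (_ : b = - q)%R // -aq; ring.
rewrite sE; congr (k (_, _)).
transitivity ((p ^+ 2 + q ^+ 2) * (y ^+ 2 + t ^+ 2))%R; last by ring.
by rewrite pq mul1r.
Qed.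

(** Reflecting [y] changes the sign of [p] and keeps [y ^+ 2], which reduces negative [p] to the
    previous case. *)
Lemma ge0_integral_rotation (p q : R) : (p ^+ 2 + q ^+ 2 = 1)%R ->
  \int[leb]_y \int[leb]_t k (y ^+ 2 + t ^+ 2, p * y + q * t)%R =
  \int[leb]_y \int[leb]_t k (y ^+ 2 + t ^+ 2, y)%R.
Proof.
move=> pq; have [p0|/ltW p0] := leP 0%R p; first exact: ge0_integral_rotation_nonneg.
rewrite -[LHS]ge0_integral_opp; last 2 first.
- by apply: measurable_integralf => //; measurability.
- by move=> y; exact: integral_ge0.
have Np0 : (0 <= - p)%R by rewrite oppr_ge0.
have Npq : ((- p) ^+ 2 + q ^+ 2 = 1)%R by rewrite sqrrN.
rewrite -(ge0_integral_rotation_nonneg Np0 Npq).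
apply: eq_integral => y _; apply: eq_integral => t _.
by rewrite sqrrN mulrN -mulNr.
Qed.

End plane_rotation.

(** * The law of a square under Lebesgue measure *)

Section square_substitution.
Local Open Scope ereal_scope.
Variable R : realType.
Local Notation leb := (@lebesgue_measure R).
Local Notation pw := (@power_density R).

(** The factor in [t] alone that is left when the kernel [F] below is rescaled by the square root of
    [w]; its integral is the constant of the substitution. *)
Let kappa (t : R) : R :=
  ((0 < t)%R%:R * t `^ (-3) * (t ^+ 2 < 1)%R%:R * (1 < 2 * t ^+ 2)%R%:R)%R.

(** Replacing [t] by [Num.sqrt w * t], with Jacobian [Num.sqrt w], separates the variables of the
    kernel. *)
Let dilate_left (w t : R) : (0 < w)%R ->
  (Num.sqrt w * ((0 < Num.sqrt w * t)%R%:R * (Num.sqrt w * t) `^ (-2) *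
    ((Num.sqrt w * t) ^+ 2 < w)%R%:R * (w < 2 * (Num.sqrt w * t) ^+ 2)%R%:R) =
  pw 2^-1 w * kappa t * t)%R.
Proof.
move=> w0; have sw0 : (0 < Num.sqrt w)%R by rewrite sqrtr_gt0.
have ww := sqr_sqrtr (ltW w0).
have wE : (w `^ (2^-1 - 1) = (Num.sqrt w)^-1)%R.
  rewrite powRB; last by rewrite (gt_eqF w0) implybT.
  rewrite powR12_sqrt ?ltW// powRr1 ?ltW// -[X in (_ / X)%R]ww.
  by field; rewrite gt_eqF.
rewrite /kappa /power_density w0 wE mul1r pmulr_rgt0// exprMn ww.
have -> : (w * t ^+ 2 < w)%R = (t ^+ 2 < 1)%R by rewrite -[ltRHS]mulr1 ltr_pM2l.
have -> : (w < 2 * (w * t ^+ 2))%R = (1 < 2 * t ^+ 2)%R.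
  by rewrite mulrCA -[ltLHS]mulr1 ltr_pM2l.
have [t0|t0] := ltP 0%R t; last by rewrite !(mul0r, mulr0).
rewrite powR_invn; last by rewrite ltW// mulr_gt0.
rewrite powR_invn; last exact: ltW.
by field; rewrite !gt_eqF.
Qed.

(** Homogeneity of the density under [w] to [t ^+ 2 * w], with the Jacobian [t ^+ 2] included. *)
Let dilate_right (w t : R) : (0 < t)%R ->
  (t ^+ 2 * pw 2^-1 (t ^+ 2 * w) = t * pw 2^-1 w)%R.
Proof.
move=> t0; rewrite power_densityM ?exprn_gt0//.
have -> : ((t ^+ 2) `^ (2^-1 - 1) = t^-1)%R.
  rewrite -powR_mulrn ?(ltW t0)// -powRrM mulrBr divff//.
  rewrite mulr1 (_ : 1 - 2 = -1)%R; last by ring.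
  by rewrite powR_inv1 ?(ltW t0).
by field; rewrite gt_eqF.
Qed.

(* The law of t ^ 2 under the Lebesgue measure on the half-line is determined,
   up to a constant, by the way it behaves under dilations; both sides are
   compared with the integral of f (t ^ 2) / t ^ 2 over t ^ 2 < w < 2 t ^ 2. *)
Lemma square_substitution : exists2 K : \bar R, 0 <= K &
  forall f : R -> \bar R, measurable_fun [set: R] f -> (forall x, 0 <= f x) ->
  \int[leb]_t ((0 < t)%R%:R%:E * f (t ^+ 2)%R) =
  K * \int[leb]_w ((pw 2^-1 w)%:E * f w).
Proof.
have kappa0 t : (0 <= kappa t)%R by rewrite /kappa !mulr_ge0// powR_ge0.
have mkappa : measurable_fun [set: R] kappa by rewrite /kappa; measurability.
(* The constant is only known to be nonnegative here; [square_substitution_real] shows that it is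
   positive and finite. *)
exists (\int[leb]_t (kappa t)%:E); first by apply: integral_ge0 => t _; rewrite lee_fin.
move=> f mf f0.
pose F (t w : R) := ((0 < t)%R%:R * t `^ (-2) * (t ^+ 2 < w)%R%:R * (w < 2 * t ^+ 2)%R%:R)%:E
   * f (t ^+ 2)%R.
have F0 t w : 0 <= F t w by rewrite /F mule_ge0// lee_fin !mulr_ge0// powR_ge0.
transitivity (\int[leb]_t \int[leb]_w F t w).
  apply: eq_integral => t _; have [t0|t0] := ltP 0%R t; last first.
    by rewrite mul0e integral0_eq// => w _; rewrite /F ltNge t0/= !mul0r mul0e.
  have t20 : (0 < t ^+ 2)%R by rewrite exprn_gt0.
  pose I : set R := `](t ^+ 2)%R, (2 * t ^+ 2)%R[%classic.
  (* The window [I] has length [t ^+ 2], which cancels the factor [t] to the power -2. *)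
  transitivity (\int[leb]_w (((t `^ (-2))%R%:E * f (t ^+ 2)%R) * (\1_I w)%R%:E)).
    rewrite ge0_integralZl//; last 2 first.
    - by apply: measurable_EFinf; apply: measurable_indic; exact: measurable_itv.
    - by rewrite mule_ge0// lee_fin powR_ge0.
    rewrite integral_indic//; last exact: measurable_itv.
    rewrite setIT /I/= lebesgue_measure_itv/= lte_fin ifT; last by lra.
    rewrite mul1e -EFinB muleAC -EFinM powR_invn; last exact: ltW.
    by rewrite (_ : _ * _ = 1)%R ?mul1e//; field; rewrite gt_eqF.
  apply: eq_integral => w _; rewrite /F t0 mul1r muleAC -EFinM indicE mem_setE in_itv/=.
  by case: (_ < w)%R; case: (w < _)%R; rewrite /= ?mulr0 ?mulr1.
rewrite (ge0_lebesgue_swap (f := F)); last 2 first.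
- by rewrite /F; measurability.
- by [].
pose G (w t : R) := (pw 2^-1 w * kappa t * t)%:E * f (w * t ^+ 2)%R.
have G0 w t : 0 <= G w t.
  rewrite /G; have [t0|t0] := ltP 0%R t.
    by rewrite mule_ge0// lee_fin mulr_ge0 ?(ltW t0)// mulr_ge0// power_density_ge0.
  by rewrite /kappa ltNge t0/= !mul0r mulr0 !mul0r mul0e.
transitivity (\int[leb]_w \int[leb]_t G w t).
  apply: eq_integral => w _; have [w0|w0] := ltP 0%R w; last first.
    rewrite !integral0_eq// => t _; first by rewrite /G /power_density ltNge w0/= !mul0r mul0e.
    rewrite /F (_ : (t ^+ 2 < w)%R = false) ?mulr0 ?mul0r ?mul0e//.
    by apply/negbTE; rewrite -leNgt (le_trans w0)// sqr_ge0.
  have sw0 : (0 < Num.sqrt w)%R by rewrite sqrtr_gt0.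
  rewrite (ge0_integral_scale sw0); last 2 first.
  - by rewrite /F; measurability.
  - by [].
  rewrite -ge0_integralZl//; last by rewrite /F; measurability.
  apply: eq_integral => t _; rewrite /F /G.
  by rewrite muleA -EFinM dilate_left// exprMn sqr_sqrtr// ltW.
rewrite (ge0_lebesgue_swap (f := G)); last 2 first.
- by rewrite /G; measurability.
- by [].
transitivity (\int[leb]_t ((kappa t)%:E * \int[leb]_w ((pw 2^-1 w)%:E * f w))).
  apply: eq_integral => t _; have [t0|t0] := ltP 0%R t; last first.
    have kt0 : kappa t = 0%R by rewrite /kappa ltNge t0/= !mul0r.
    rewrite kt0 mul0e integral0_eq// => w _.
    by rewrite /G kt0 mulr0 mul0r mul0e.
  have t20 : (0 < t ^+ 2)%R by rewrite exprn_gt0.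
  rewrite [in RHS](ge0_integral_scale t20); last 2 first.
  - by measurability.
  - by move=> w; rewrite mule_ge0// lee_fin power_density_ge0.
  rewrite muleA -EFinM -ge0_integralZl//; last 3 first.
  - by measurability.
  - by move=> w _; rewrite mule_ge0// lee_fin power_density_ge0.
  - by rewrite lee_fin mulr_ge0// ltW.
  apply: eq_integral => w _; rewrite /G muleA -EFinM (mulrC w); congr (_%:E * _).
  by rewrite -[in RHS]mulrA dilate_right//; ring.
rewrite ge0_integralZr//.
- by measurability.
- by move=> t _; rewrite lee_fin.
- by apply: integral_ge0 => w _; rewrite mule_ge0// lee_fin power_density_ge0.
Qed.

End square_substitution.

(** * Sum and ratio of two variables with power densities *)

Section beta_convolution.
Local Open Scope ereal_scope.
Variable R : realType.
Local Notation leb := (@lebesgue_measure R).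
Local Notation pw := (@power_density R).

Definition beta_density (p q x b : R) : R :=
  (pw p b * pw q (1 - b) * (b < x)%R%:R)%R.

Lemma beta_density_ge0 p q x b : (0 <= beta_density p q x b)%R.
Proof. by apply: mulr_ge0 => //; apply: mulr_ge0; exact: power_density_ge0. Qed.

Lemma measurable_beta_density p q x : measurable_fun [set: R] (beta_density p q x).
Proof. by rewrite /beta_density; measurability. Qed.

(** Substitute [v = w + s], then [s = v * b]. By homogeneity the densities and the Jacobian [v] give
    the power density of parameter [p + q] in [v] times a function of [b], and the constraint
    becomes [b < x]. *)
Lemma beta_convolution (p q x : R) (h : R -> \bar R) :
  measurable_fun [set: R] h -> (forall v, 0 <= h v) ->
  \int[leb]_w \int[leb]_s ((pw q w * pw p s * (s < x * (w + s))%R%:R)%:E * h (w + s)%R) =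
  (\int[leb]_b (beta_density p q x b)%:E) * \int[leb]_v ((pw (p + q) v)%:E * h v).
Proof.
move=> mh h0.
have mbeta := measurable_beta_density p q x.
have Ih0 : 0 <= \int[leb]_b (beta_density p q x b)%:E.
  by apply: integral_ge0 => b _; rewrite lee_fin beta_density_ge0.
pose F w s := (pw q w * pw p s * (s < x * (w + s))%R%:R)%:E * h (w + s)%R.
have F0 w s : 0 <= F w s.
  rewrite mule_ge0// lee_fin; apply: mulr_ge0 => //.
  by apply: mulr_ge0; exact: power_density_ge0.
pose H s v := (pw q (v - s) * pw p s * (s < x * v)%R%:R)%:E * h v.
have H0 s v : 0 <= H s v.
  rewrite mule_ge0// lee_fin; apply: mulr_ge0 => //.
  by apply: mulr_ge0; exact: power_density_ge0.
rewrite (ge0_lebesgue_swap (f := F)); last 2 first.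
- by rewrite /F; measurability.
- by [].
transitivity (\int[leb]_s \int[leb]_v H s v).
  apply: eq_integral => s _.
  rewrite -(ge0_integral_translate (f := F ^~ s) (- s)); last 2 first.
  - by rewrite /F; measurability.
  - by [].
  by apply: eq_integral => v _; rewrite /F subrK.
rewrite (ge0_lebesgue_swap (f := H)); last 2 first.
- by rewrite /H; measurability.
- by [].
rewrite -ge0_integralZl//; last 2 first.
- by measurability.
- by move=> v _; rewrite mule_ge0// lee_fin power_density_ge0.
apply: eq_integral => v _; have [v0|v0] := ltP 0%R v; last first.
  rewrite (power_density_le0 _ v0) mul0e mule0 integral0_eq// => s _; rewrite /H.
  have [s0|s0] := leP s 0%R.
    by rewrite (power_density_le0 p s0) mulr0 mul0r mul0e.
  rewrite (power_density_le0 q (s := (v - s)%R)) ?mul0r ?mul0e// subr_le0.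
  exact: le_trans v0 (ltW s0).
rewrite (ge0_integral_scale v0 (f := H ^~ v)); last 2 first.
- by rewrite /H; measurability.
- by [].
rewrite -ge0_integralZl//; last 2 first.
- by rewrite /H; measurability.
- by rewrite lee_fin ltW.
rewrite -ge0_integralZr//; last 3 first.
- by measurability.
- by move=> b _; rewrite lee_fin beta_density_ge0.
- by rewrite mule_ge0// lee_fin power_density_ge0.
apply: eq_integral => b _; rewrite /H !muleA -!EFinM; congr (_%:E * _).
rewrite (_ : v - v * b = v * (1 - b))%R; last by ring.
rewrite !power_densityM// (mulrC x) ltr_pM2l// /beta_density.
have -> : (pw (p + q) v = v * v `^ (p - 1) * v `^ (q - 1))%R.
  rewrite /power_density v0 mul1r -[X in (X * _ * _)%R]powRr1 ?ltW// -!powRD ?(gt_eqF v0) ?implybT//.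
  by congr (_ `^ _)%R; ring.
by ring.
Qed.

End beta_convolution.

Section lebesgue_misc.
Local Open Scope ereal_scope.
Variable R : realType.
Local Notation leb := (@lebesgue_measure R).
Local Notation pw := (@power_density R).

(** If the integral were 0, [f] would vanish almost everywhere, but []a, b[] is not null. *)
Lemma lebesgue_integral_gt0 (f : R -> R) (a b : R) : (a < b)%R ->
  measurable_fun [set: R] f -> (forall x, (0 <= f x)%R) ->
  (forall x, (a < x < b)%R -> (0 < f x)%R) -> 0 < \int[leb]_x (f x)%:E.
Proof.
move=> ab mf f0 fab; rewrite lt_neqAle integral_ge0 ?andbT; last first.
  by move=> x _; rewrite lee_fin.
apply/eqP => /esym int0.
have : \int[leb]_x `|(f x)%:E| = 0.
  by rewrite -int0; apply: eq_integral => x _; rewrite gee0_abs// lee_fin.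
move=> /(ae_eq_integral_abs leb measurableT (measurable_EFinf mf)) [N [mN N0 sub]].
have abN : `]a, b[%classic `<=` N.
  move=> x/=; rewrite in_itv/= => xab; apply: sub => /= /(_ Logic.I) [fx0].
  by have := fab x xab; rewrite fx0 ltxx.
have : leb `]a, b[%classic <= leb N.
  by apply: le_measure; rewrite ?inE//; exact: measurable_itv.
by rewrite N0 lebesgue_measure_itv/= lte_fin ab -EFinB lee_fin leNgt subr_gt0 ab.
Qed.

Lemma ge0_integral_even (f : R -> \bar R) :
  measurable_fun [set: R] f -> (forall x, 0 <= f x) ->
  (forall x, f (- x)%R = f x) ->
  \int[leb]_x f x = 2%:E * \int[leb]_x ((0 < x)%R%:R%:E * f x).
Proof.
move=> mf f0 fN.
(* The origin is null; the open and the closed half-line are both used because one and the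
   reflection of the other partition the line. *)
have pos_nonneg : \int[leb]_x ((0 < x)%R%:R%:E * f x) = \int[leb]_x ((0 <= x)%R%:R%:E * f x).
  transitivity (\int[leb]_(x in `]0%R, +oo[) f x).
    rewrite [RHS]integral_mkcond; apply: eq_integral => x _.
    by rewrite patchE mem_setE in_itv/= andbT; case: ifP; rewrite ?mul1e ?mul0e.
  rewrite integral_itv_obnd_cbnd; last exact: measurable_funTS.
  rewrite [LHS]integral_mkcond; apply: eq_integral => x _.
  by rewrite patchE mem_setE in_itv/= andbT; case: ifP; rewrite ?mul1e ?mul0e.
transitivity (\int[leb]_x ((0 < x)%R%:R%:E * f x) + \int[leb]_x ((0 <= x)%R%:R%:E * f x)).
  rewrite -[X in X + _]ge0_integral_opp; last 2 first.
  - by measurability.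
  - by move=> x; rewrite mule_ge0// lee_fin.
  rewrite -ge0_integralD//; last 4 first.
  - by move=> x _; rewrite mule_ge0// lee_fin.
  - by measurability.
  - by move=> x _; rewrite mule_ge0// lee_fin.
  - by measurability.
  apply: eq_integral => x _; rewrite fN oppr_gt0 ltNge.
  by case: (0 <= x)%R; rewrite /= ?mul1e ?mul0e ?adde0 ?add0e.
by rewrite -pos_nonneg -mule2n mule_natl.
Qed.

Lemma lebesgue_unit_interval : \int[leb]_y (y ^+ 2 <= 1)%R%:R%:E = 2%:E.
Proof.
transitivity (\int[leb]_y (\1_(`[(-1)%R, 1%R]) y)%R%:E).
  apply: eq_integral => y _; rewrite indicE mem_setE in_itv/=.
  by rewrite -[in LHS]real_normK ?num_real// expr_le1// ler_norml.
rewrite integral_indic//= setIT lebesgue_measure_itv/= lte_fin ifT; last lra.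
by rewrite -EFinB opprK.
Qed.

End lebesgue_misc.

(** * Rotation invariance and radial laws in Euclidean space *)

Section euclidean_space.
Local Open Scope ereal_scope.
Variable R : realType.
Local Notation leb := (@lebesgue_measure R).
Local Notation pw := (@power_density R).

Lemma power_density_unit_ball_gt0 (a : R) :
  0 < \int[leb]_v ((pw a v)%:E * (v <= 1)%R%:R%:E).
Proof.
under eq_integral do rewrite -EFinM.
apply: (@lebesgue_integral_gt0 _ _ 0 1)%R => //.
- by measurability.
- by move=> v; rewrite mulr_ge0// power_density_ge0.
- move=> v /andP[v0 v1]; rewrite (ltW v1) mulr1 /power_density v0 mul1r.
  by rewrite powR_gt0.
Qed.

Lemma beta_density_integral_gt0 (p q x : R) : (0 < x <= 1)%R ->
  0 < \int[leb]_b (beta_density p q x b)%:E.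
Proof.
move=> /andP[x0 x1]; apply: (@lebesgue_integral_gt0 _ _ 0 x)%R => //.
- exact: measurable_beta_density.
- by move=> b; exact: beta_density_ge0.
- move=> b /andP[b0 bx]; have b1 : (0 < 1 - b)%R by lra.
  by rewrite /beta_density /power_density b0 bx b1 !mul1r mulr1 mulr_gt0// powR_gt0.
Qed.

(** Tested on the indicator of [w <= 1], the left side is 1 and the integral on the right is
    positive, so the constant is neither 0 nor infinite. *)
Lemma square_substitution_real : exists2 K : R, (0 < K)%R &
  forall f : R -> \bar R, measurable_fun [set: R] f -> (forall x, 0 <= f x) ->
  \int[leb]_t ((0 < t)%R%:R%:E * f (t ^+ 2)%R) =
  K%:E * \int[leb]_w ((pw 2^-1 w)%:E * f w).
Proof.
have [K K0 HK] := square_substitution R.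
have := HK (fun w => (w <= 1)%R%:R%:E).
have W0 := power_density_unit_ball_gt0 2^-1.
have -> : \int[leb]_t ((0 < t)%R%:R%:E * (t ^+ 2 <= 1)%R%:R%:E) = 1.
  have := lebesgue_unit_interval R; rewrite ge0_integral_even.
  - have : 0 <= \int[leb]_x ((0 < x)%R%:R%:E * (x ^+ 2 <= 1)%R%:R%:E).
      by apply: integral_ge0 => x _; rewrite -EFinM lee_fin mulr_ge0.
    case: (integral _ _ _) => [v| |]//; last by rewrite mulry gtr0_sg// mul1e.
    by rewrite -EFinM => _ [] v2; congr EFin; lra.
  - by measurability.
  - by move=> x; rewrite lee_fin.
  - by move=> x; rewrite sqrrN.
move=> KW; have {}KW : K * \int[leb]_v ((pw 2^-1 v)%:E * (v <= 1)%R%:R%:E) = 1.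
  by rewrite -KW//; measurability.
move: K K0 HK KW => [K| |]// K0 HK KW.
  exists K => //; rewrite lt_neqAle -lee_fin K0 andbT; apply/eqP => K00.
  by move: KW; rewrite -K00 mul0e => -[] /eqP; rewrite eq_sym oner_eq0.
by move: KW; rewrite gt0_mulye.
Qed.

Section sqnorm.
Context d (T : measurableType d) (mu : {sigma_finite_measure set T -> \bar R}).
Variables (m : nat) (X : 'I_m -> T -> R).

Definition sqnorm (x : T) : R := (\sum_i X i x ^+ 2)%R.

Lemma sqnorm_ge0 x : (0 <= sqnorm x)%R.
Proof. by apply: sumr_ge0 => i _; exact: sqr_ge0. Qed.

Lemma measurable_sqnorm : (forall i, measurable_fun [set: T] (X i)) ->
  measurable_fun [set: T] sqnorm.
Proof.
by move=> mX; apply: measurable_sumf => i; apply: measurable_expf.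
Qed.

Definition cons_coord (i : 'I_m.+1) (z : R * T) : R :=
  if unlift ord0 i is Some j then X j z.2 else z.1.

Lemma cons_coord0 z : cons_coord ord0 z = z.1.
Proof. by rewrite /cons_coord unlift_none. Qed.

Lemma cons_coordS i z : cons_coord (lift ord0 i) z = X i z.2.
Proof. by rewrite /cons_coord liftK. Qed.

Lemma sqnorm_cons_coord z : (\sum_i cons_coord i z ^+ 2 = z.1 ^+ 2 + sqnorm z.2)%R.
Proof.
rewrite big_ord_recl cons_coord0; congr (_ + _)%R.
by apply: eq_bigr => i _; rewrite cons_coordS.
Qed.

Lemma dot_cons_coord (u : 'I_m.+1 -> R) z :
  (\sum_i u i * cons_coord i z = u ord0 * z.1 + \sum_i u (lift ord0 i) * X i z.2)%R.
Proof.
rewrite big_ord_recl cons_coord0; congr (_ + _)%R.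
by apply: eq_bigr => i _; rewrite cons_coordS.
Qed.

Lemma measurable_cons_coord : (forall i, measurable_fun [set: T] (X i)) ->
  forall i, measurable_fun [set: R * T] (cons_coord i).
Proof.
move=> mX i; rewrite /cons_coord; case: unlift => [j|]; last exact: measurable_fst.
exact: (measurableT_comp (mX j) measurable_snd).
Qed.

End sqnorm.

(* An m-dimensional Euclidean space, given as a measure space with coordinate
   functions X: the measure of R * T is invariant under rotations, and the
   squared norm has a power law. *)
Definition euclidean d (T : measurableType d) (mu : {sigma_finite_measure set T -> \bar R})
    (m : nat) (X : 'I_m -> T -> R) (c : R) : Prop :=
  [/\ forall i, measurable_fun [set: T] (X i),
      forall u : 'I_m.+1 -> R, (\sum_i u i ^+ 2 = 1)%R ->
        forall g : R * R -> \bar R, measurable_fun [set: R * R] g -> (forall z, 0 <= g z) ->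
        \int[leb]_y \int[mu]_x g (y ^+ 2 + sqnorm X x,
          u ord0 * y + \sum_i u (lift ord0 i) * X i x)%R =
        \int[leb]_y \int[mu]_x g (y ^+ 2 + sqnorm X x, y)%R,
      (0 < c)%R,
      forall h : R -> \bar R, measurable_fun [set: R] h -> (forall s, 0 <= h s) ->
        \int[mu]_x h (sqnorm X x) = c%:E * \int[leb]_s ((pw (m%:R / 2) s)%:E * h s)
    & \int[mu]_x (sqnorm X x <= 1)%R%:R%:E < +oo].

Section cone.
Context d (T : measurableType d) (mu : {sigma_finite_measure set T -> \bar R}).
Variables (m : nat) (X : 'I_m -> T -> R) (c : R).
Hypothesis eX : euclidean mu X c.

(** Both [y ^+ 2] on the half-line and the squared norm on [T] have power densities, of parameters
    1/2 and [m%:R / 2], so [beta_convolution] splits the integral over the cone into a beta factor,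
    which carries [x], and a radial one. *)
Lemma euclidean_halfspace K (h : R -> \bar R) (x : R) :
  (forall f : R -> \bar R, measurable_fun [set: R] f -> (forall x, 0 <= f x) ->
   \int[leb]_t ((0 < t)%R%:R%:E * f (t ^+ 2)%R) =
   K%:E * \int[leb]_w ((pw 2^-1 w)%:E * f w)) ->
  measurable_fun [set: R] h -> (forall s, 0 <= h s) ->
  \int[leb]_y ((0 < y)%R%:R%:E * \int[mu]_t
    ((sqnorm X t < x * (y ^+ 2 + sqnorm X t))%R%:R%:E * h (y ^+ 2 + sqnorm X t)%R)) =
  (K * c)%:E * ((\int[leb]_b (beta_density (m%:R / 2) 2^-1 x b)%:E) *
    \int[leb]_v ((pw (m.+1%:R / 2) v)%:E * h v)).
Proof.
move=> HK mh h0; have [mX _ c0 rad _] := eX.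
pose f w := \int[leb]_s ((pw (m%:R / 2) s)%:E *
   ((s < x * (w + s))%R%:R%:E * h (w + s)%R)).
have f0 w : 0 <= f w.
  apply: integral_ge0 => s _; rewrite mule_ge0 ?lee_fin ?power_density_ge0//.
  by rewrite mule_ge0// lee_fin.
have mf : measurable_fun [set: R] f.
  apply: (measurable_integralf leb); last first.
    move=> w s; rewrite mule_ge0 ?lee_fin ?power_density_ge0//.
    by rewrite mule_ge0// lee_fin.
  by measurability.
have cf y : \int[mu]_t ((sqnorm X t < x * (y ^+ 2 + sqnorm X t))%R%:R%:E *
    h (y ^+ 2 + sqnorm X t)%R) = c%:E * f (y ^+ 2)%R.
  rewrite (rad (fun s => (s < x * (y ^+ 2 + s))%R%:R%:E * h (y ^+ 2 + s)%R))//.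
    by measurability.
  by move=> s; rewrite mule_ge0// lee_fin.
under eq_integral do rewrite cf muleCA.
rewrite ge0_integralZl//; last 3 first.
- by measurability.
- by move=> y _; rewrite mule_ge0// lee_fin.
- by rewrite lee_fin ltW.
rewrite HK// muleA -EFinM (mulrC c); congr (_ * _).
rewrite (_ : m.+1%:R / 2 = m%:R / 2 + 2^-1)%R; last by rewrite -addn1 natrD mulrDl mul1r.
rewrite -beta_convolution//; apply: eq_integral => w _.
rewrite -ge0_integralZl//; last 3 first.
- by measurability.
- move=> s _; rewrite mule_ge0 ?lee_fin ?power_density_ge0//.
  by rewrite mule_ge0// lee_fin.
- by rewrite lee_fin power_density_ge0.
by apply: eq_integral => s _; rewrite !muleA -!EFinM.
Qed.

(** For [x = 1] the cone is the whole open half-space [0 < y]; evenness in [y] accounts for the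
    factor 2. *)
Lemma euclidean_total K (h : R -> \bar R) :
  (forall f : R -> \bar R, measurable_fun [set: R] f -> (forall x, 0 <= f x) ->
   \int[leb]_t ((0 < t)%R%:R%:E * f (t ^+ 2)%R) =
   K%:E * \int[leb]_w ((pw 2^-1 w)%:E * f w)) ->
  measurable_fun [set: R] h -> (forall s, 0 <= h s) ->
  \int[leb]_y \int[mu]_t h (y ^+ 2 + sqnorm X t)%R =
  (2 * (K * c))%:E * ((\int[leb]_b (beta_density (m%:R / 2) 2^-1 1 b)%:E) *
    \int[leb]_v ((pw (m.+1%:R / 2) v)%:E * h v)).
Proof.
move=> HK mh h0; have [mX _ c0 rad _] := eX.
have mS := measurable_sqnorm mX.
rewrite ge0_integral_even; last 3 first.
- by apply: (measurable_integralf mu) => //; measurability.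
- by move=> y; exact: integral_ge0.
- by move=> y; under eq_integral do rewrite sqrrN.
rewrite EFinM -muleA -(euclidean_halfspace 1 HK mh h0); congr (_ * _).
apply: eq_integral => y _; have [y0|y0] := ltP 0%R y; last by rewrite !mul0e.
rewrite !mul1e; apply: eq_integral => t _.
by rewrite mul1r ltrDr exprn_gt0// mul1e.
Qed.

(** The unit ball lies in the product of [[-1, 1]] with the unit ball of [T]. *)
Lemma euclidean_ball_finite :
  \int[leb]_y \int[mu]_t (y ^+ 2 + sqnorm X t <= 1)%R%:R%:E < +oo.
Proof.
have [mX _ _ _ fin] := eX; have mS := measurable_sqnorm mX.
set B := \int[mu]_x _ in fin.
have B0 : 0 <= B by apply: integral_ge0 => x _; rewrite lee_fin.
apply: (@le_lt_trans _ _ (\int[leb]_y ((y ^+ 2 <= 1)%R%:R%:E * B))); last first.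
  rewrite ge0_integralZr//; last by measurability.
  by rewrite lebesgue_unit_interval lte_mul_pinfty// lee_fin.
apply: ge0_le_integral => //.
- by move=> y _; apply: integral_ge0 => t _; rewrite lee_fin.
- apply: (measurable_integralf mu); last by move=> y t; rewrite lee_fin.
  by measurability.
- by measurability.
move=> y _; rewrite /B -ge0_integralZl//; last by measurability.
apply: ge0_le_integral => //.
- by measurability.
- by measurability.
move=> t _; rewrite -EFinM lee_fin -natrM ler_nat mulnb.
have S0 := sqnorm_ge0 X t; have y0 := sqr_ge0 y.
by case: (lerP (_ + _)) => //= h; rewrite lt0b; apply/andP; split; lra.
Qed.

End cone.
End euclidean_space.

Lemma unit_direction (R : rcfType) (m : nat) (v : 'I_m.+1 -> R) :
  exists2 e : 'I_m.+1 -> R, \sum_i e i ^+ 2 = 1 &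
    forall i, v i = Num.sqrt (\sum_j v j ^+ 2) * e i.
Proof.
set w := Num.sqrt _.
have v0 : 0 <= \sum_j v j ^+ 2 by apply: sumr_ge0 => i _; exact: sqr_ge0.
have ww : w ^+ 2 = \sum_j v j ^+ 2 by rewrite sqr_sqrtr.
have [w0|w0] := eqVneq w 0; last first.
  exists (fun i => v i / w) => [|i]; last by rewrite mulrC mulfVK.
  under eq_bigr do rewrite exprMn.
  by rewrite -mulr_suml -ww -exprMn divff// expr1n.
(* The zero vector takes the first basis vector as its direction. *)
exists (fun i => (i == ord0)%:R) => [|i].
  by rewrite big_ord_recl/= expr1n big1 ?addr0// => i _; rewrite expr0n.
rewrite w0 mul0r; apply/eqP; rewrite -sqrf_eq0; apply/eqP; move: i isT.
by apply/psumr_eq0P; [move=> i _; exact: sqr_ge0|rewrite -ww w0 expr0n].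
Qed.

Section euclidean_existence.
Local Open Scope ereal_scope.
Variable R : realType.
Local Notation leb := (@lebesgue_measure R).
Local Notation pw := (@power_density R).

Lemma euclidean_line : exists c : R,
  euclidean (leb : {sigma_finite_measure set (measurableTypeR R) -> \bar R})
    (fun (_ : 'I_1) (t : measurableTypeR R) => t : R) c.
Proof.
have [K K0 HK] := square_substitution_real R.
(* Each half-line contributes [K]. *)
exists (2 * K)%R; rewrite /euclidean.
have SE (t : R) : sqnorm (fun (_ : 'I_1) (t : measurableTypeR R) => t : R) t = (t ^+ 2)%R.
  by rewrite /sqnorm big_ord1.
split.
- by move=> _; exact: measurable_id.
- move=> u u1 g mg g0.
  rewrite big_ord_recl big_ord1 in u1.
  rewrite -[RHS](_ : \int[leb]_y \int[leb]_t g (y ^+ 2 + t ^+ 2, y)%R = _); last first.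
    by apply: eq_integral => y _; apply: eq_integral => t _; rewrite SE.
  rewrite -(ge0_integral_rotation mg g0 u1).
  by apply: eq_integral => y _; apply: eq_integral => t _; rewrite SE big_ord1.
- by rewrite mulr_gt0.
- move=> h mh h0; rewrite mul1r.
  rewrite -[LHS](_ : \int[leb]_t h (t ^+ 2)%R = _); last first.
    by apply: eq_integral => t _; rewrite SE.
  rewrite ge0_integral_even; last 3 first.
  + by measurability.
  + by [].
  + by move=> t; rewrite sqrrN.
  by rewrite HK// muleA -EFinM.
- rewrite -[X in X < _](_ : \int[leb]_t (t ^+ 2 <= 1)%R%:R%:E = _); last first.
    by apply: eq_integral => t _; rewrite SE.
  by rewrite lebesgue_unit_interval ltry.
Qed.

(* For \x, unification only finds the sigma-finite structure of a product of
   probabilities, so the one of the general case is packed by hand. *)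
Definition sigma_finite_product d1 d2 (T1 : measurableType d1) (T2 : measurableType d2)
    (m1 : {sigma_finite_measure set T1 -> \bar R})
    (m2 : {sigma_finite_measure set T2 -> \bar R}) :
    {sigma_finite_measure set (T1 * T2)%type -> \bar R} :=
  HB.pack (m1 \x m2)
    (lebesgue_integral_fubini.measure_function_Measure_isSigmaFinite__to__measure_function_isSigmaFinite m1 m2)
    (lebesgue_integral_fubini.measure_function_Measure_isSigmaFinite__to__measure_function_isSFinite m1 m2).

Section succ.
Context d (T : measurableType d) (mu : {sigma_finite_measure set T -> \bar R}).
Variables (m : nat) (X : 'I_m.+1 -> T -> R) (c : R).
Hypothesis eX : euclidean mu X c.

Let mu' : {sigma_finite_measure set (measurableTypeR R * T)%type -> \bar R} :=
  sigma_finite_product leb mu.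
Let X' : 'I_m.+2 -> (measurableTypeR R * T)%type -> R := cons_coord X.

Let sqnorm_cons z : sqnorm X' z = (z.1 ^+ 2 + sqnorm X z.2)%R.
Proof. exact: sqnorm_cons_coord. Qed.

Let integral_cons (f : R -> T -> \bar R) :
  measurable_fun [set: (measurableTypeR R * T)%type] (fun z => f z.1 z.2) ->
  (forall y x, 0 <= f y x) ->
  \int[mu']_z f z.1 z.2 = \int[leb]_y \int[mu]_x f y x.
Proof.
move=> mf f0.
exact: (@fubini_tonelli1 _ _ (measurableTypeR R) T R leb mu
  (fun z => f z.1 z.2) mf (fun z => f0 z.1 z.2)).
Qed.

Let mX : forall i, measurable_fun [set: T] (X i). Proof. by have [] := eX. Qed.
Let mS : measurable_fun [set: T] (sqnorm X). Proof. exact: measurable_sqnorm. Qed.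

(** Write [u] as [u ord0] followed by [w] times a unit vector [e]. At fixed [y], the invariance of
    [R * T] brings [e] to the coordinate [t]; a rotation of the plane of [y] and [t] does the
    rest. *)
Let rotation (u : 'I_m.+3 -> R) : (\sum_i u i ^+ 2 = 1)%R ->
  forall g : R * R -> \bar R, measurable_fun [set: R * R] g -> (forall z, 0 <= g z) ->
  \int[leb]_y \int[mu']_x g (y ^+ 2 + sqnorm X' x,
          u ord0 * y + \sum_i u (lift ord0 i) * X' i x)%R =
  \int[leb]_y \int[mu']_x g (y ^+ 2 + sqnorm X' x, y)%R.
Proof.
move=> u1 g mg g0; have [_ rot _ _ _] := eX.
have [e e1 ue] := unit_direction (fun i => u (lift ord0 i)).
set w := Num.sqrt _ in ue.
have uw : (u ord0 ^+ 2 + w ^+ 2 = 1)%R.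
  rewrite sqr_sqrtr ?sumr_ge0// => [|i _]; last exact: sqr_ge0.
  by rewrite -u1 [in RHS]big_ord_recl.
(* Integrating [T] out leaves a function of [y ^+ 2 + t ^+ 2] and a linear form in [y] and [t], as
   the plane rotation requires. *)
pose k (z : R * R) : \bar R := \int[mu]_x g (z.1 + sqnorm X x, z.2)%R.
have mk : measurable_fun [set: R * R] k.
  by apply: (measurable_integralf mu) => [|z x]; [measurability|].
have k0 z : 0 <= k z by apply: integral_ge0.
transitivity (\int[leb]_y \int[leb]_t k (y ^+ 2 + t ^+ 2, u ord0 * y + w * t)%R).
  apply: eq_integral => y _.
  pose gy (z : R * R) := g (y ^+ 2 + z.1, u ord0 * y + w * z.2)%R.
  have mgy : measurable_fun [set: R * R] gy by rewrite /gy; measurability.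
  transitivity (\int[leb]_t \int[mu]_x gy (t ^+ 2 + sqnorm X x,
      e ord0 * t + \sum_i e (lift ord0 i) * X i x)%R).
    rewrite -integral_cons; last 2 first.
    - rewrite /gy; measurability; apply: measurable_sumf => i; measurability.
      exact: (measurableT_comp (mX i)).
    - by move=> t x; exact: g0.
    apply: eq_integral => z _; rewrite /gy/= sqnorm_cons; congr (g (_, _ + _)%R).
    rewrite (dot_cons_coord X (fun i => u (lift ord0 i))) ue mulrDr mulrA mulr_sumr.
    by congr (_ + _)%R; apply: eq_bigr => i _; rewrite ue mulrA.
  rewrite rot//; last by move=> z; exact: g0.
  by apply: eq_integral => t _; apply: eq_integral => x _; rewrite /gy/= addrA.
rewrite (ge0_integral_rotation mk k0 uw); apply: eq_integral => y _.
transitivity (\int[leb]_t \int[mu]_x g (y ^+ 2 + (t ^+ 2 + sqnorm X x), y)%R).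
  by apply: eq_integral => t _; apply: eq_integral => x _ /=; rewrite addrA.
rewrite -(integral_cons (f := fun t x => g (y ^+ 2 + (t ^+ 2 + sqnorm X x), y)%R))//.
  by apply: eq_integral => z _; rewrite sqnorm_cons.
by measurability.
Qed.

Let ball : \int[mu']_x (sqnorm X' x <= 1)%R%:R%:E < +oo.
Proof.
rewrite [ltLHS](_ : _ = \int[leb]_y \int[mu]_t (y ^+ 2 + sqnorm X t <= 1)%R%:R%:E).
  exact: (euclidean_ball_finite eX).
rewrite -(integral_cons (f := fun y t => (y ^+ 2 + sqnorm X t <= 1)%R%:R%:E)).
- by apply: eq_integral => z _; rewrite sqnorm_cons.
- by measurability.
- by move=> y t; rewrite lee_fin.
Qed.

(** The radial constant is [2 * (K * c)] times the complete beta integral [B]. It is finite because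
    its product with a positive radial integral is the measure of the unit ball. *)
Lemma euclidean_succ : exists c' : R, euclidean mu' X' c'.
Proof.
have [K K0 HK] := square_substitution_real R.
have [_ _ c0 _ _] := eX.
set B := \int[leb]_b (beta_density (m.+1%:R / 2) 2^-1 1 b)%:E.
have rad (h : R -> \bar R) : measurable_fun [set: R] h -> (forall s, 0 <= h s) ->
    \int[mu']_x h (sqnorm X' x) = ((2 * (K * c))%:E * B) *
      \int[leb]_s ((pw (m.+2%:R / 2) s)%:E * h s).
  move=> mh h0; rewrite -muleA -(euclidean_total eX HK mh h0).
  rewrite -(integral_cons (f := fun y t => h (y ^+ 2 + sqnorm X t)%R))//.
    by apply: eq_integral => z _; rewrite sqnorm_cons.
  by measurability.
have B0 : 0 < B by apply: beta_density_integral_gt0; rewrite ltr01 lexx.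
have C0 : 0 < (2 * (K * c))%:E * B by rewrite mule_gt0// lte_fin !mulr_gt0.
have W0 := power_density_unit_ball_gt0 (m.+2%:R / 2 : R).
have := ball; rewrite (rad (fun s => (s <= 1)%R%:R%:E)); last 2 first.
- by measurability.
- by move=> s; rewrite lee_fin.
move: C0 rad; case: (_ * B) => [c'| |]// c'0 rad.
  by exists c'; split => //; exact: measurable_cons_coord.
by rewrite gt0_mulye.
Qed.

End succ.

Lemma euclidean_exists (m : nat) :
  exists (d : measure_display) (T : measurableType d)
    (mu : {sigma_finite_measure set T -> \bar R}) (X : 'I_m.+1 -> T -> R) (c : R),
  euclidean mu X c.
Proof.
elim: m => [|m [d [T [mu [X [c eX]]]]]].
  by have [c eX] := euclidean_line; do 5 eexists; exact: eX.
by have [c' eX'] := euclidean_succ eX; do 5 eexists; exact: eX'.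
Qed.

End euclidean_existence.

(** * Packing of cones *)

Lemma sum_exclusive_le1 (R : numDomainType) (I : finType) (b : I -> bool) :
  (forall i j, i != j -> b i -> b j -> False) -> \sum_i (b i)%:R <= 1 :> R.
Proof.
move=> excl; case: (pickP b) => [i bi|b0].
  rewrite (bigD1 i)//= bi big1 ?addr0// => j ji.
  by have [/(excl _ _ ji)/(_ bi)|] := boolP (b j).
by rewrite big1// => i _; rewrite b0.
Qed.

Section cap_packing.
Variable R : realType.

(* The vector z belongs to the open cone around the unit vector u of angular
   radius a, where sin a ^ 2 = x; v is the squared norm of z and t its inner
   product with u. *)
Definition in_cone (x v t : R) : bool := (0 < t) && (v - t ^+ 2 < x * v).

(** In both cones, [s] and [t] are positive with squares above [(1 - x) * v], so [(s + t) ^+ 2]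
    exceeds [4 * ((1 - x) * v)]. Cauchy-Schwarz for [u + w], whose square is
    [2 + 2 * G <= 4 * (1 - x)], says the opposite. *)
Lemma cone_disjoint (m : nat) (u w z : 'I_m -> R) (x : R) :
  \sum_k u k ^+ 2 = 1 -> \sum_k w k ^+ 2 = 1 -> \sum_k u k * w k <= 1 - 2 * x ->
  in_cone x (\sum_k z k ^+ 2) (\sum_k u k * z k) ->
  in_cone x (\sum_k z k ^+ 2) (\sum_k w k * z k) -> False.
Proof.
move=> u1 w1 uw; have := sum_CauchySchwarz (fun k => u k + w k) z.
have -> : \sum_k (u k + w k) * z k = \sum_k u k * z k + \sum_k w k * z k.
  by rewrite -big_split; apply: eq_bigr => k _; rewrite mulrDl.
have -> : \sum_k (u k + w k) ^+ 2 = 2 + 2 * \sum_k u k * w k.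
  transitivity (\sum_k u k ^+ 2 + \sum_k w k ^+ 2 + 2 * \sum_k u k * w k).
    by rewrite mulr_sumr -!big_split; apply: eq_bigr => k _ /=; ring.
  by rewrite u1 w1; ring.
have : 0 <= \sum_k z k ^+ 2 by apply: sumr_ge0 => k _; exact: sqr_ge0.
set v := \sum_k z k ^+ 2; set s := \sum_k u k * z k; set t := \sum_k w k * z k.
move: uw; set G := \sum_k u k * w k => uw v0 cs /andP[s0 sv] /andP[t0 tv].
have {}cs : (s + t) ^+ 2 <= 4 * ((1 - x) * v).
  by apply: (le_trans cs); rewrite mulrA ler_wpM2r//; lra.
(* The cross term [s * t] is at least the smaller of the two squares. *)
have [st|/ltW ts] := leP s t.
  have : s ^+ 2 <= s * t by rewrite expr2 ler_pM2l.
  nra.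
have : t ^+ 2 <= s * t by rewrite expr2 ler_pM2r.
nra.
Qed.

Local Open Scope ereal_scope.
Local Notation leb := (@lebesgue_measure R).

(** The endpoints of [[0, x]] are null, and [b < x <= 1] makes the cutoff at 1 automatic. Because of
    [fine], finiteness has to come from elsewhere. *)
Lemma incomplete_betaE (x p q : R) : (0 < x <= 1)%R ->
  incomplete_beta x p q = fine (\int[leb]_b (beta_density p q x b)%:E).
Proof.
move=> /andP[x0 x1]; rewrite /incomplete_beta /Rintegral; congr fine.
rewrite integral_itv_bndoo; last first.
  by apply: measurable_funTS; apply: measurable_EFinf; measurability.
rewrite integral_mkcond; apply: eq_integral => b _.
rewrite patchE mem_setE in_itv/= /beta_density /power_density subr_gt0.
have [b0|b0] := ltP 0%R b; last by rewrite !mul0r.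
have [bx|bx] := ltP b x; last by rewrite mulr0.
by rewrite (lt_le_trans bx x1) !mul1r mulr1.
Qed.

(** Measures are compared in the unit ball of [R * T], with [T] of dimension [m.+1]: [N] disjoint
    cones of measure [K * c * b * W] fit into the total [2 * (K * c) * B * W]. *)
Lemma cap_packing (m N : nat) (u : 'I_N -> 'I_m.+2 -> R) (x : R) :
  (0 < x <= 1)%R -> (forall i, \sum_k u i k ^+ 2 = 1)%R ->
  (forall i j, i != j -> \sum_k u i k * u j k <= 1 - 2 * x)%R ->
  (N%:R <= 2 * beta (m.+1%:R / 2) 2^-1 / incomplete_beta x (m.+1%:R / 2) 2^-1)%R.
Proof.
move=> x01 u1 uu.
have [d [T [mu [X [c eX]]]]] := euclidean_exists R m.
have [K K0 HK] := square_substitution_real R.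
have [mX rot c0 _ _] := eX; have mS := measurable_sqnorm mX.
pose h (v : R) : \bar R := (v <= 1)%R%:R%:E.
have mh : measurable_fun [set: R] h by rewrite /h; measurability.
have h0 v : 0 <= h v by rewrite lee_fin.
pose ind v t : R := ((0 < t)%R%:R * (v - t ^+ 2 < x * v)%R%:R)%R.
have indE v t : ind v t = (in_cone x v t)%:R by rewrite /ind /in_cone -natrM mulnb.
pose g (z : R * R) : \bar R := (ind z.1 z.2)%:E * h z.1.
have mg : measurable_fun [set: R * R] g by rewrite /g /ind; measurability.
have g0 z : 0 <= g z by rewrite /g mule_ge0// lee_fin indE.
pose dot i y s := (u i ord0 * y + \sum_k u i (lift ord0 k) * X k s)%R.
have mdot i : measurable_fun [set: R * T] (fun z => dot i z.1 z.2).
  rewrite /dot; measurability; apply: measurable_sumf => k; measurability.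
  exact: (measurableT_comp (mX k)).
have mS2 : measurable_fun [set: R * T] (fun z => z.1 ^+ 2 + sqnorm X z.2)%R by measurability.
have mgi i : measurable_fun [set: R * T]
    (fun z => g (z.1 ^+ 2 + sqnorm X z.2, dot i z.1 z.2)%R).
  by apply: measurable_comp2f.
have mgiy i y : measurable_fun [set: T] (fun s => g (y ^+ 2 + sqnorm X s, dot i y s)%R).
  exact: (measurableT_comp (mgi i) (measurable_pair1 y)).
have coneE i : \int[leb]_y \int[mu]_s g (y ^+ 2 + sqnorm X s, dot i y s)%R =
    (K * c)%:E * ((\int[leb]_b (beta_density (m.+1%:R / 2) 2^-1 x b)%:E) *
    \int[leb]_v ((power_density (m.+2%:R / 2) v)%:E * h v)).
  rewrite /dot (rot _ (u1 i) _ mg g0) -(euclidean_halfspace eX x HK mh h0).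
  apply: eq_integral => y _; rewrite -ge0_integralZl//; last 2 first.
  - by measurability.
  - by move=> s _; rewrite mule_ge0// lee_fin.
  apply: eq_integral => s _; rewrite /g /ind /= EFinM -muleA.
  by rewrite (_ : y ^+ 2 + sqnorm X s - y ^+ 2 = sqnorm X s)%R; last by ring.
have total := euclidean_total eX HK mh h0.
have fin := euclidean_ball_finite eX.
have sum_le : \sum_(i < N) \int[leb]_y \int[mu]_s g (y ^+ 2 + sqnorm X s, dot i y s)%R <=
    \int[leb]_y \int[mu]_s h (y ^+ 2 + sqnorm X s)%R.
  rewrite -ge0_integral_sum//; last 2 first.
  - by move=> i; apply: (measurable_integralf mu) => //; exact: mgi.
  - by move=> i y _; exact: integral_ge0.
  apply: ge0_le_integral => //.
  - by move=> y _; apply: sume_ge0 => i _; exact: integral_ge0.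
  - by apply: emeasurable_sum => i; apply: (measurable_integralf mu) => //; exact: mgi.
  - by apply: (measurable_integralf mu) => [|y s]; [measurability|].
  move=> y _; rewrite -ge0_integral_sum//.
  apply: ge0_le_integral => //.
  - by move=> s _; exact: sume_ge0.
  - by apply: emeasurable_sum => i; exact: mgiy.
  - by measurability.
  move=> s _; rewrite /g/=; under eq_bigr do rewrite /= indE.
  rewrite -ge0_sume_distrl; last by move=> i _; rewrite lee_fin.
  rewrite -[leRHS]mul1e; apply: lee_wpmul2r => //.
  (* Each point lies in at most one cone. *)
  rewrite sumEFin lee_fin; apply: sum_exclusive_le1 => i j ij.
  have := @cone_disjoint _ (u i) (u j) (fun k => cons_coord X k (y, s)) x
    (u1 i) (u1 j) (uu _ _ ij).
  by rewrite sqnorm_cons_coord !dot_cons_coord.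
move: sum_le; under eq_bigr do rewrite coneE; rewrite total.
move: fin; rewrite -/(h _) total.
have B1 : 0 < \int[leb]_b (beta_density (m.+1%:R / 2) 2^-1 1 b)%:E.
  by apply: beta_density_integral_gt0; rewrite ltr01 lexx.
have Bx := beta_density_integral_gt0 (m.+1%:R / 2) 2^-1 x01.
have W0 : 0 < \int[leb]_v ((power_density (m.+2%:R / 2) v)%:E * h v).
  exact: power_density_unit_ball_gt0.
rewrite /beta !incomplete_betaE// ?ltr01 ?lexx//.
move: B1 Bx W0; set B := \int[leb]_b (beta_density _ _ 1 b)%:E.
set b := \int[leb]_b (beta_density _ _ x b)%:E; set W := integral _ _ _.
have bB : b <= B.
  apply: ge0_le_integral => //.
  - by move=> t _; rewrite lee_fin beta_density_ge0.
  - by apply: measurable_EFinf; exact: measurable_beta_density.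
  - by apply: measurable_EFinf; exact: measurable_beta_density.
  move=> t _; rewrite lee_fin /beta_density; apply: ler_wpM2l.
    by rewrite mulr_ge0// power_density_ge0.
  by rewrite ler_nat; case: (ltP t x) => //= tx; rewrite lt0b; lra.
have Kc : (0 < K * c)%R by rewrite mulr_gt0.
(* Finiteness of the unit ball rules out infinite [W] or [B], after which [K * c * W] cancels. *)
case: W => [W| |] //; case: B bB => [B| |]// bB B0 b0 W0.
- move: b bB b0 => [b| |]//= bB b0 _.
  under eq_bigr do rewrite -!EFinM.
  rewrite sumEFin sumr_const card_ord -!EFinM !lee_fin => sum_le.
  rewrite !lte_fin in W0 b0; rewrite ler_pdivlMr//.
  rewrite -(ler_pM2r (mulr_gt0 Kc W0)); move: sum_le; rewrite -mulr_natl.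
  by congr (_ <= _)%R; ring.
- by rewrite gt0_mulye// gt0_muley// lte_fin mulr_gt0.
- by rewrite gt0_muley// gt0_muley// lte_fin mulr_gt0.
- by rewrite mulyy gt0_muley// lte_fin mulr_gt0.
Qed.

End cap_packing.

(** * From touching spheres to packed cones *)

Theorem theorem2p1 (R : realType) (n : nat) (r : R) (hn : (2 <= n)%N) (hr : 0 <= r) :
  (kissing_number n r <=
   (2 * beta ((n%:R - 1) / 2) (1 / 2)
    / incomplete_beta (sech r ^+ 2 / 4) ((n%:R - 1) / 2) (1 / 2))%:E)%E.
Proof.
case: n hn => [|[|m]] // _.
have -> : m.+2%:R - 1 = m.+1%:R :> R by rewrite -[m.+2]addn1 natrD addrK.
rewrite !div1r; set x := sech r ^+ 2 / 4.
have x01 : 0 < x <= 1.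
  have cosh1 : 1 <= cosh r.
    move: hr; rewrite le_eqVlt => /predU1P[<-|/cosh_gt1/ltW//].
    by rewrite /cosh oppr0 expR0; lra.
  have sechE : sech r = (cosh r)^-1 by rewrite /sech /cosh invf_div.
  have s0 : 0 < sech r by rewrite sechE invr_gt0; lra.
  have s1 : sech r <= 1 by rewrite sechE invf_le1//; lra.
  by rewrite /x; apply/andP; split; nra.
apply: ge_ereal_sup => _ [N [c0 [c kc]] <-]; rewrite lee_fin.
move: hr; rewrite le_eqVlt => /predU1P[r0|r0]; last first.
  have [u [u1 uu]] := kissing_unit_vectors r0 kc.
  apply: (cap_packing x01 u1) => i j ij.
  by apply: (le_trans (uu i j ij)); rewrite /x; lra.
rewrite -r0 in kc; apply: (@le_trans _ _ 1%:R).
  by rewrite ler_nat (kissing_radius0 kc).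
(* For [r = 0] it remains to bound the right side below by 1, which follows from packing a single
   cone around the first basis vector. *)
apply: (@cap_packing _ m 1 (fun _ k => (k == ord0)%:R) x x01) => [i|i j].
  by rewrite big_ord_recl/= expr1n big1 ?addr0// => k _; rewrite expr0n.
by rewrite !ord1.
Qed.
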